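(* For every choice of $\delta$ with $2^{-o(\sqrt{n})} < \delta < \frac{1}{n^2}$, there is a parameter $m$ with $1/\delta \leq m \leq \frac{2n\ln n}{\delta}$ and unit vectors $v_1, \dots, v_m \in S^{n-1}$ such that for any $x \in S^{n-1}$ there is some $v_i$ with \[\langle x, v_i\rangle \geq \sqrt{\frac{2\ln\frac{m}{n}}{n}}\cdot\left(1 - o\left(\frac{1}{\sqrt{\log\frac{m}{n}}}\right)\right).\]
   Context: $S^{n-1} = \{x \in \mathbb{R}^n : \|x\|_2 = 1\}$. Asymptotic notation is as $n \to \infty$, with $\delta$ and $m$ functions of $n$. $\ln$ is the natural logarithm and $\log$ is base $2$. *)

(* Defs.v *)
From mathcomp Require Export all_boot all_order all_algebra.
From mathcomp Require Export all_classical all_reals all_analysis.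
Export Order.TTheory GRing.Theory Num.Theory.
Export numFieldNormedType.Exports.

Set Implicit Arguments.
Unset Strict Implicit.
Unset Printing Implicit Defensive.

Local Open Scope classical_set_scope.
Local Open Scope ring_scope.

Definition dot (R : realType) (n : nat) (u v : 'rV[R]_n) : R :=
  \sum_(i < n) u 0 i * v 0 i.

(* The library's norm on row vectors is the sup norm, so the Euclidean norm
   has to be introduced separately. *)
Definition norm2 (R : realType) (n : nat) (x : 'rV[R]_n) : R :=
  Num.sqrt (dot x x).

(* The index is the ambient dimension: [sphere R n] is S^{n-1}. *)
Definition sphere (R : realType) (n : nat) : set 'rV[R]_n :=
  [set x | norm2 x = 1].

Arguments sphere : clear implicits.

Definition log2 (R : realType) (x : R) : R := ln x / ln 2.

(* Main.v *)
Require Import Defs.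
From mathcomp Require Import ring lra zify.

Set Implicit Arguments.
Unset Strict Implicit.
Unset Printing Implicit Defensive.

Local Open Scope classical_set_scope.
Local Open Scope ring_scope.

(* Sample the [v_i] from a discrete Gaussian: independent coordinates on a grid
   [h Z] truncated to [2 K + 1] values, with weights proportional to
   [expR (- y ^+ 2 / 2)]. For a fixed unit vector [x], a sample [g] satisfies
   [dot x g >= s] and [norm2 g <= sqrt n (1 + o(1 / s))] with probability at
   least [expR (- s ^+ 2 / 2 - O(1)) / s]: a grid translation multiplies the
   weights by an explicit factor, which reduces this to a central event
   controlled by Chebyshev's inequality. Neither rotation invariance nor the
   exact law of [dot x g] is needed. With [m = ceil (1 / delta)],
   [L = ln (m / n)] and [s = sqrt (2 L) - (2 L) ^ (-1/4)], this probability
   times [m] exceeds the logarithm of the number [(2 K + 1) ^ n] of grid points,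
   so a greedy choice of [m] samples serves all directions rounded to the grid,
   hence, up to [O(1 / n ^ 2)], every point of the sphere. Since
   [ln n <= L <= sqrt n] for large [n], all errors are [O((2 L) ^ (-3/4))]
   relative to [sqrt (2 L / n)]. For the finitely many small [n], [e n] is
   chosen so large that the bound follows from Cauchy-Schwarz. *)

(** * Euclidean inner product *)

Lemma dotC (R : realType) (n : nat) (u v : 'rV[R]_n) : dot u v = dot v u.
Proof. by apply: eq_bigr => i _; rewrite mulrC. Qed.

Lemma dotDl (R : realType) (n : nat) (u v w : 'rV[R]_n) :
  dot (u + v) w = dot u w + dot v w.
Proof. by rewrite -big_split; apply: eq_bigr => i _; rewrite !mxE mulrDl. Qed.

Lemma dotDr (R : realType) (n : nat) (u v w : 'rV[R]_n) :
  dot w (u + v) = dot w u + dot w v.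
Proof. by rewrite dotC dotDl !(dotC w). Qed.

Lemma dotZl (R : realType) (n : nat) (a : R) (u v : 'rV[R]_n) :
  dot (a *: u) v = a * dot u v.
Proof. by rewrite mulr_sumr; apply: eq_bigr => i _; rewrite !mxE mulrA. Qed.

Lemma dotZr (R : realType) (n : nat) (a : R) (u v : 'rV[R]_n) :
  dot u (a *: v) = a * dot u v.
Proof. by rewrite dotC dotZl dotC. Qed.

Lemma dotBl (R : realType) (n : nat) (u v w : 'rV[R]_n) :
  dot (u - v) w = dot u w - dot v w.
Proof. by rewrite -scaleN1r dotDl dotZl mulN1r. Qed.

Lemma dot_ge0 (R : realType) (n : nat) (u : 'rV[R]_n) : 0 <= dot u u.
Proof. by apply: sumr_ge0 => i _; rewrite -expr2 sqr_ge0. Qed.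

Lemma norm2_ge0 (R : realType) (n : nat) (u : 'rV[R]_n) : 0 <= norm2 u.
Proof. exact: sqrtr_ge0. Qed.

Lemma sqr_norm2 (R : realType) (n : nat) (u : 'rV[R]_n) :
  norm2 u ^+ 2 = dot u u.
Proof. by rewrite sqr_sqrtr // dot_ge0. Qed.

Lemma dot_eq0 (R : realType) (n : nat) (u v : 'rV[R]_n) :
  dot u u = 0 -> dot u v = 0.
Proof.
move=> u0; apply: big1 => i _.
have /eqP : u 0 i * u 0 i = 0.
  by apply: (psumr_eq0P _ u0) => // j _; rewrite -expr2 sqr_ge0.
by rewrite mulf_eq0 orbb => /eqP ->; rewrite mul0r.
Qed.

(** Cauchy-Schwarz: the squared norm of [dot v v *: u - dot u v *: v] is [dot v v] times the defect
    of the inequality. *)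
Lemma dot_sqr_le (R : realType) (n : nat) (u v : 'rV[R]_n) :
  dot u v ^+ 2 <= dot u u * dot v v.
Proof.
have [v0|v0] := eqVneq (dot v v) 0.
  by rewrite dotC (dot_eq0 _ v0) v0 expr0n mulr0.
have vgt0 : 0 < dot v v by rewrite lt_def v0 dot_ge0.
have := dot_ge0 (dot v v *: u - dot u v *: v).
rewrite dotBl !(dotC _ (_ - _)) !dotBl !dotZl !dotZr (dotC v u).
set a := dot u u; set b := dot u v; set c := dot v v.
have -> : c * (c * a) - b * (c * b) - (c * (b * b) - b * (b * c)) =
  c * (a * c - b ^+ 2) by ring.
by rewrite pmulr_rge0 // subr_ge0.
Qed.

Lemma normr_dot_le (R : realType) (n : nat) (u v : 'rV[R]_n) :
  `|dot u v| <= norm2 u * norm2 v.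
Proof.
rewrite -(@ler_pXn2r _ 2) ?nnegrE ?mulr_ge0 ?norm2_ge0 //.
by rewrite real_normK ?num_real // exprMn !sqr_norm2 dot_sqr_le.
Qed.

Lemma dot_le (R : realType) (n : nat) (u v : 'rV[R]_n) :
  dot u v <= norm2 u * norm2 v.
Proof. exact: le_trans (ler_norm _) (normr_dot_le u v). Qed.

Lemma norm2_coord_le (R : realType) (n : nat) (u : 'rV[R]_n) (i : 'I_n) :
  `|u 0 i| <= norm2 u.
Proof.
rewrite -(@ler_pXn2r _ 2) ?nnegrE ?norm2_ge0 // sqr_norm2.
rewrite real_normK ?num_real // /dot (bigD1 i) //= -expr2 lerDl.
by apply: sumr_ge0 => j _; rewrite -expr2 sqr_ge0.
Qed.

(** * Finite probability *)

Lemma sum_prod_ffun (R : realType) (n : nat) (I : finType)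
    (F : 'I_n -> I -> R) :
  \sum_(w : {ffun 'I_n -> I}) \prod_i F i (w i) = \prod_i \sum_k F i k.
Proof. by rewrite (bigA_distr_bigA F). Qed.

Definition prod_weight (R : realType) (n : nat) (I : finType) (q : I -> R)
  (w : {ffun 'I_n -> I}) : R := \prod_i q (w i).

Lemma prod_weight_ge0 (R : realType) (n : nat) (I : finType) (q : I -> R) :
  (forall k, 0 <= q k) -> forall w : {ffun 'I_n -> I}, 0 <= prod_weight q w.
Proof. by move=> q0 w; apply: prodr_ge0 => i _. Qed.

Lemma sum_prod_weight (R : realType) (n : nat) (I : finType) (q : I -> R) :
  \sum_k q k = 1 -> \sum_(w : {ffun 'I_n -> I}) prod_weight q w = 1.
Proof.
by move=> q1; rewrite (sum_prod_ffun (fun=> q)) big1.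
Qed.

(** Independence of two distinct coordinates: the integrand is a product over all coordinates, and
    every factor other than [i] and [j] sums to 1. *)
Lemma prod_weight_cross (R : realType) (n : nat) (I : finType) (q : I -> R)
    (a b : I -> R) (i j : 'I_n) :
    \sum_k q k = 1 -> i != j ->
  \sum_(w : {ffun 'I_n -> I}) prod_weight q w * (a (w i) * b (w j)) =
  (\sum_k q k * a k) * (\sum_k q k * b k).
Proof.
move=> q1 ij.
have ji : (j == i) = false by rewrite eq_sym (negbTE ij).
pose F l k := q k * (if l == i then a k else if l == j then b k else 1).
have -> : \sum_(w : {ffun 'I_n -> I}) prod_weight q w * (a (w i) * b (w j)) =
    \sum_(w : {ffun 'I_n -> I}) \prod_l F l (w l).
  apply: eq_bigr => w _; rewrite /F big_split /=; congr (_ * _).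
  rewrite (bigD1 i) //= eqxx; congr (_ * _).
  rewrite (bigD1 j) ?ji //= eqxx big1 ?mulr1 //.
  by move=> l /andP[/negbTE -> /negbTE ->].
rewrite sum_prod_ffun (bigD1 i) //= (bigD1 j) ?ji //=
  [X in _ * (_ * X)]big1 ?mulr1.
  congr (_ * _); apply: eq_bigr => k _; rewrite /F ?eqxx // //.
  by rewrite ji.
move=> l /andP[/negbTE li /negbTE lj].
by rewrite -[RHS]q1; apply: eq_bigr => k _; rewrite /F li lj mulr1.
Qed.

Lemma prod_weight_marginal (R : realType) (n : nat) (I : finType) (q : I -> R)
    (a : I -> R) (i : 'I_n) :
    \sum_k q k = 1 ->
  \sum_(w : {ffun 'I_n -> I}) prod_weight q w * a (w i) = \sum_k q k * a k.
Proof.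
move=> q1.
pose F l k := q k * (if l == i then a k else 1).
have -> : \sum_(w : {ffun 'I_n -> I}) prod_weight q w * a (w i) =
    \sum_(w : {ffun 'I_n -> I}) \prod_l F l (w l).
  apply: eq_bigr => w _; rewrite /F big_split /=; congr (_ * _).
  rewrite (bigD1 i) //= eqxx big1 ?mulr1 // => l /negbTE -> //.
rewrite sum_prod_ffun (bigD1 i) //= [X in _ * X]big1 ?mulr1.
  by apply: eq_bigr => k _; rewrite /F eqxx.
move=> l /negbTE li.
by rewrite -[RHS]q1; apply: eq_bigr => k _; rewrite /F li mulr1.
Qed.

(** Variances of independent centred variables add up, because the cross terms factor into vanishing
    means. *)
Lemma prod_weight_variance (R : realType) (n : nat) (I : finType) (q : I -> R)
    (a : 'I_n -> I -> R) :
    \sum_k q k = 1 -> (forall i, \sum_k q k * a i k = 0) ->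
  \sum_(w : {ffun 'I_n -> I}) prod_weight q w * (\sum_i a i (w i)) ^+ 2 =
  \sum_i \sum_k q k * a i k ^+ 2.
Proof.
move=> q1 a0.
under eq_bigr do rewrite expr2 big_distrlr /= mulr_sumr.
rewrite exchange_big; apply: eq_bigr => i _.
under eq_bigr do rewrite mulr_sumr.
rewrite exchange_big (bigD1 i) //= [X in _ + X]big1 ?addr0.
  by rewrite (prod_weight_marginal (fun k => a i k * a i k) i q1).
by move=> j ji; rewrite (prod_weight_cross (a i) (a j) q1) 1?eq_sym // a0 mul0r.
Qed.

Lemma sum_markov (R : realType) (T : finType) (P X : T -> R) (c : R) :
    (forall w, 0 <= P w) -> (forall w, 0 <= X w) ->
  c * (\sum_(w | c <= X w) P w) <= \sum_w P w * X w.
Proof.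
move=> P0 X0; rewrite mulr_sumr [leRHS](bigID (fun w => c <= X w)) /=.
rewrite -[leLHS]addr0 lerD //.
  by apply: ler_sum => w cX; rewrite mulrC ler_wpM2l.
by apply: sumr_ge0 => w _; rewrite mulr_ge0.
Qed.

Lemma exists_le_average (R : realType) (T : finType) (P X : T -> R) :
    (forall w, 0 <= P w) -> \sum_w P w = 1 ->
  exists w, X w <= \sum_w' P w' * X w'.
Proof.
move=> P0 P1; set A := \sum_w' _; apply/not_existsP => XA.
have XA' w : A < X w by rewrite ltNge; apply/negP/XA.
have le w : P w * A <= P w * X w by rewrite ler_wpM2l // ltW.
have eqA : \sum_w P w * X w = \sum_w P w * A by rewrite -mulr_suml P1 mul1r.
have Pz w : P w = 0.
  have /eqP : P w * X w - P w * A = 0.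
    apply: (@psumr_eq0P _ _ xpredT (fun w => P w * X w - P w * A)) => //.
      by move=> i _; rewrite subr_ge0.
    by rewrite sumrB eqA subrr.
  by rewrite -mulrBr mulf_eq0 subr_eq0 (gt_eqF (XA' w)) orbF => /eqP.
by move: P1; rewrite big1 // => /esym/eqP; rewrite oner_eq0.
Qed.

(** Averaged over a new sample, the number of targets still missed shrinks by the factor [1 - p];
    some sample does at least as well as the average, and it is added to the list. *)
Lemma greedy_cover (R : realType) (Z W : finType) (P : W -> R)
    (hit : Z -> pred W) (p : R) :
    (forall w, 0 <= P w) -> \sum_w P w = 1 -> p <= 1 ->
    (forall z, p <= \sum_(w | hit z w) P w) ->
  forall m, exists2 s : seq W, size s = m &
    (#|[pred z | ~~ has (hit z) s]|%:R : R) <= #|Z|%:R * (1 - p) ^+ m.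
Proof.
move=> P0 P1 p1 hitp; elim=> [|m [s sm IH]].
  by exists [::] => //; rewrite expr0 mulr1 ler_nat max_card.
pose U := [pred z | ~~ has (hit z) s].
pose X w : R := #|[pred z | ~~ has (hit z) (w :: s)]|%:R.
have [w Xw] := exists_le_average X P0 P1.
exists (w :: s); first by rewrite /= sm.
rewrite exprSr mulrA; apply: le_trans Xw _.
apply: (@le_trans _ _ (#|U|%:R * (1 - p))); last first.
  by rewrite ler_wpM2r // subr_ge0.
have -> : \sum_w' P w' * X w' = \sum_(z in U) \sum_(w' | ~~ hit z w') P w'.
  rewrite (exchange_big_dep predT) //=; apply: eq_bigr => w' _.
  rewrite sumr_const mulr_natr /X; congr (_ *+ _).
  by apply: eq_card => z; rewrite !inE /= negb_or andbC.
rewrite mulr_natl -sumr_const ler_sum // => z _.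
have : \sum_(w' | hit z w') P w' + \sum_(w' | ~~ hit z w') P w' = 1.
  by rewrite -P1 [RHS](bigID (hit z)).
by move: (hitp z); lra.
Qed.

(** * Lower bounds for the exponential and for sinh *)

Lemma expR_ge_quad (R : realType) (u : R) :
  0 <= u -> 1 + u + u ^+ 2 / 2 <= expR u.
Proof.
move=> u0.
have nd : nondecreasing_seq (series (exp_coeff u)).
  by apply: nondecreasing_series => i _ _; exact: exp_coeff_ge0.
have := nondecreasing_cvgn_le nd (is_cvg_series_exp_coeff u) 3.
rewrite /series /= !big_nat_recr //= big_geq // add0r /exp_coeff /=.
by rewrite expr0 expr1 !divr1.
Qed.

Lemma expR_sinh_ge (R : realType) (u : R) :
  0 <= u -> 2 * u <= expR u - expR (- u).
Proof.
move=> u0; have E := expR_ge_quad u0.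
set D := 1 + u + u ^+ 2 / 2 in E.
have D0 : 0 < D by rewrite /D; nra.
have : expR (- u) <= D^-1 by rewrite expRN lef_pV2 // posrE expR_gt0.
suff : 2 * u <= D - D^-1 by lra.
have DV : D * D^-1 = 1 by rewrite mulfV // gt_eqF.
rewrite -(ler_pM2r D0) mulrBl (mulrC _^-1) DV /D.
(* With the denominator cleared, the difference of the two sides is exactly [u ^+ 4 / 4]. *)
by have := exprn_ge0 4 u0; nra.
Qed.

Lemma expR_sinh_mul_ge (R : realType) (u b : R) :
  0 <= b * u -> 2 * (b * u) <= b * (expR u - expR (- u)).
Proof.
move=> bu; have [u0|u0] := leP 0 u.
  have [b0|b0] := leP 0 b.
    by rewrite mulrCA ler_wpM2l // expR_sinh_ge.
  have -> : u = 0 by nra.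
  by rewrite oppr0 subrr !mulr0.
have b0 : b <= 0 by nra.
have := @expR_sinh_ge R (- u); rewrite opprK => /(_ ltac:(lra)).
by nra.
Qed.

(** * The discrete Gaussian *)

Definition gauss (R : realType) (y : R) : R := expR (- (y ^+ 2 / 2)).

(** The index is a natural number, not an ordinal, so that summation by parts may step to [K.*2.+1],
    one place beyond the support. *)
Definition grid (R : realType) (h : R) (K k : nat) : R := h * (k%:R - K%:R).

Lemma gauss_gt0 (R : realType) (y : R) : 0 < gauss y.
Proof. exact: expR_gt0. Qed.

Lemma gaussN (R : realType) (y : R) : gauss (- y) = gauss y.
Proof. by rewrite /gauss sqrrN. Qed.

Lemma gauss_shift (R : realType) (y h : R) :
  gauss (y + h) = gauss y * expR (- (h ^+ 2 / 2)) * expR (- (h * y)).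
Proof. by rewrite /gauss -!expRD; congr expR; field. Qed.

Lemma gridS (R : realType) (h : R) (K k : nat) :
  grid h K k.+1 = grid h K k + h.
Proof. by rewrite /grid -natr1; ring. Qed.

Definition gauss_mass (R : realType) (h : R) (K : nat) : R :=
  \sum_(k < K.*2.+1) gauss (grid h K k).

Definition gauss_prob (R : realType) (h : R) (K : nat) (k : 'I_K.*2.+1) : R :=
  gauss (grid h K k) / gauss_mass h K.

Lemma gauss_mass_gt0 (R : realType) (h : R) (K : nat) : 0 < gauss_mass h K.
Proof.
rewrite /gauss_mass big_ord_recl /= ltr_pwDl ?gauss_gt0 //.
by apply: sumr_ge0 => k _; rewrite ltW ?gauss_gt0.
Qed.

Lemma sum_gauss_prob (R : realType) (h : R) (K : nat) :
  \sum_(k < K.*2.+1) gauss_prob h k = 1.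
Proof. by rewrite -mulr_suml mulfV // gt_eqF ?gauss_mass_gt0. Qed.

Lemma gauss_prob_ge0 (R : realType) (h : R) (K : nat) (k : 'I_K.*2.+1) :
  0 <= gauss_prob h k.
Proof. by rewrite divr_ge0 // ltW ?gauss_gt0 ?gauss_mass_gt0. Qed.

Lemma gauss_prob_moment (R : realType) (h : R) (K : nat) (F : R -> R) :
  \sum_(k < K.*2.+1) gauss_prob h k * F (grid h K k) =
  (\sum_(k < K.*2.+1) gauss (grid h K k) * F (grid h K k)) / gauss_mass h K.
Proof. by rewrite mulr_suml; apply: eq_bigr => k _; rewrite mulrAC. Qed.

Lemma grid_rev (R : realType) (h : R) (K : nat) (k : 'I_K.*2.+1) :
  grid h K (rev_ord k) = - grid h K k.
Proof.
rewrite /grid /= subSS natrB; last by rewrite -ltnS.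
have -> : (K.*2)%:R = K%:R + K%:R :> R by rewrite -addnn natrD.
ring.
Qed.

Lemma gauss_prob_mean (R : realType) (h : R) (K : nat) :
  \sum_(k < K.*2.+1) gauss_prob h k * grid h K k = 0.
Proof.
set S := LHS; suff : S = - S by lra.
rewrite {1}/S (reindex_inj rev_ord_inj) /= -sumrN; apply: eq_bigr => k _.
by rewrite /gauss_prob grid_rev gaussN mulrN.
Qed.

(* Discrete integration by parts: [gauss (y - h) - gauss (y + h)] plays the
   role of [- 2 h gauss' y], and oddness of [F] gives the two boundary terms of
   the summation their sign. *)
Lemma gauss_stein (R : realType) (h : R) (K : nat) (F : R -> R) :
    0 <= h -> (forall y, F (- y) = - F y) ->
    (forall y, 0 <= y -> 0 <= F y) ->
  2 * h * expR (- (h ^+ 2 / 2)) *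
    (\sum_(k < K.*2.+1) gauss (grid h K k) * (grid h K k * F (grid h K k))) <=
  \sum_(k < K.*2.+1) gauss (grid h K k) *
    (F (grid h K k + h) - F (grid h K k - h)).
Proof.
move=> h0 Fodd F0.
have Fy y : 0 <= F y * (h * y).
  have [y0|y0] := leP 0 y; first by rewrite mulr_ge0 ?F0 ?mulr_ge0.
  have := F0 (- y) ltac:(lra); rewrite Fodd => Fy.
  have : 0 <= - F y * (h * - y) by apply: mulr_ge0; [|apply: mulr_ge0]; lra.
  by lra.
(* The increments of [G] are the termwise differences of the two sums, so only the boundary values
   of [G] remain. *)
pose G k := gauss (grid h K k - h) * F (grid h K k) +
            gauss (grid h K k) * F (grid h K k - h).
apply: (@le_trans _ _ (\sum_(k < K.*2.+1)
    F (grid h K k) * (gauss (grid h K k - h) - gauss (grid h K k + h)))).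
  rewrite mulr_sumr; apply: ler_sum => k _; set y := grid h K k.
  rewrite !gauss_shift sqrrN mulNr.
  have g0 : 0 <= gauss y * expR (- (h ^+ 2 / 2)).
    by rewrite mulr_ge0 ?expR_ge0 // ltW ?gauss_gt0.
  have := ler_wpM2l g0 (expR_sinh_mul_ge (Fy y)); rewrite opprK.
  set A := gauss y; set B := expR (- (h ^+ 2 / 2)).
  move=> H; apply: le_trans (_ : _ <= A * B * (2 * (F y * (h * y)))) _.
    by rewrite le_eqVlt; apply/orP; left; apply/eqP; ring.
  by apply: le_trans H _; rewrite le_eqVlt; apply/orP; left; apply/eqP; ring.
rewrite -subr_ge0 -sumrB.
have -> : \sum_(k < K.*2.+1) (gauss (grid h K k) *
      (F (grid h K k + h) - F (grid h K k - h)) -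
    F (grid h K k) * (gauss (grid h K k - h) - gauss (grid h K k + h))) =
    \sum_(0 <= k < K.*2.+1) (G k.+1 - G k).
  rewrite big_mkord; apply: eq_bigr => k _; rewrite /G gridS addrK; ring.
rewrite telescope_sumr // /G gridS addrK.
have -> : grid h K K.*2 = h * K%:R by rewrite /grid -addnn natrD; ring.
have -> : grid h K 0 = - (h * K%:R) by rewrite /grid; ring.
have -> : - (h * K%:R) - h = - (h * K%:R + h) by ring.
rewrite !gaussN !Fodd.
have K0 : 0 <= h * K%:R by rewrite mulr_ge0.
have := F0 _ K0; have := F0 (h * K%:R + h) (addr_ge0 K0 h0).
have := gauss_gt0 (h * K%:R); have := gauss_gt0 (h * K%:R + h).
set a := gauss _; set b := gauss _; set c := F _; set d := F _.
move=> a0 b0 c0 d0.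
have := mulr_ge0 (ltW a0) d0; have := mulr_ge0 (ltW b0) c0; lra.
Qed.

(** Apply [gauss_stein] to [y] and to [y ^+ 3]: the right-hand sides become [2 h] times the mass and
    [2 h (3 S2 + h ^+ 2 Z)], and [expR (- (h ^+ 2 / 2))] is at least [1 - h ^+ 2 / 2]. *)
Lemma gauss_prob_moments (R : realType) (h : R) (K : nat) :
    0 < h -> h <= 1 / 2 ->
  \sum_(k < K.*2.+1) gauss_prob h k * grid h K k ^+ 2 <= 1 + h ^+ 2 /\
  \sum_(k < K.*2.+1) gauss_prob h k * grid h K k ^+ 4 <= 5.
Proof.
move=> h0 h1.
rewrite (gauss_prob_moment h K (fun y => y ^+ 2)).
rewrite (gauss_prob_moment h K (fun y => y ^+ 4)).
have Z0 := gauss_mass_gt0 h K.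
set S2 := \sum_(k < _) _ * _ ^+ 2; set S4 := \sum_(k < _) _ * _ ^+ 4.
rewrite !ler_pdivrMr //; set Z := gauss_mass h K.
have e0 := expR_gt0 (- (h ^+ 2 / 2)).
have := expR_ge1Dx (- (h ^+ 2 / 2)); set b := expR _ => b1.
have I2 : 2 * h * b * S2 <= 2 * h * Z.
  have := @gauss_stein R h K id (ltW h0) (fun=> erefl) (fun _ => id).
  rewrite [leRHS](_ : _ = 2 * h * Z); last first.
    by rewrite mulr_sumr; apply: eq_bigr => k _ /=; ring.
  by under eq_bigr do rewrite -expr2.
have I4 : 2 * h * b * S4 <= 2 * h * (3 * S2 + h ^+ 2 * Z).
  have := @gauss_stein R h K (fun y => y ^+ 3) (ltW h0).
  move=> /(_ ltac:(by move=> y; rewrite exprNn; ring)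
             ltac:(by move=> y; exact: exprn_ge0)).
  rewrite [leRHS](_ : _ = 2 * h * (3 * S2 + h ^+ 2 * Z)); last first.
    rewrite /S2 /Z /gauss_mass !mulrDr !mulr_sumr -big_split.
    by apply: eq_bigr => k _ /=; ring.
  by under eq_bigr do rewrite -exprS.
have h2 : 0 < 2 * h by lra.
have {}I2 : b * S2 <= Z by rewrite -(ler_pM2l h2) [leLHS]mulrA.
have {}I4 : b * S4 <= 3 * S2 + h ^+ 2 * Z.
  by rewrite -(ler_pM2l h2) [leLHS]mulrA.
have S20 : 0 <= S2.
  by apply: sumr_ge0 => k _; rewrite mulr_ge0 ?sqr_ge0 // ltW ?gauss_gt0.
have S40 : 0 <= S4.
  apply: sumr_ge0 => k _; rewrite mulr_ge0 ?(ltW (gauss_gt0 _)) //.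
  by rewrite exprn_even_ge0.
have hh : h ^+ 2 <= 1 / 4 by nra.
set t := h ^+ 2 in hh b1 I4 *; have t0 : 0 <= t by exact: sqr_ge0.
have {}I2 : (1 - t / 2) * S2 <= Z by nra.
have {}I4 : (1 - t / 2) * S4 <= 3 * S2 + t * Z by nra.
(* Here [(1 + t) (1 - t / 2) = 1 + t (1 - t) / 2] is at least 1. *)
have S2b : S2 <= (1 + t) * Z.
  have : (1 + t) * ((1 - t / 2) * S2) <= (1 + t) * Z.
    by rewrite ler_pM2l //; lra.
  have : 0 <= t * (1 - t) * S2 by rewrite !mulr_ge0 //; lra.
  by lra.
split=> //.
have tZ : t * Z <= 1 / 4 * Z by rewrite ler_pM2r.
have tS : t * S4 <= 1 / 4 * S4 by rewrite ler_wpM2r.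
by lra.
Qed.

(** * Vectors with independent discrete Gaussian coordinates *)

Definition grid_vec (R : realType) (h : R) (K n : nat)
  (w : {ffun 'I_n -> 'I_K.*2.+1}) : 'rV[R]_n := \row_i grid h K (w i).

Definition gauss_vec_prob (R : realType) (h : R) (K n : nat)
  (w : {ffun 'I_n -> 'I_K.*2.+1}) : R := prod_weight (gauss_prob h (K := K)) w.

Lemma gauss_vec_prob_ge0 (R : realType) (h : R) (K n : nat)
  (w : {ffun 'I_n -> 'I_K.*2.+1}) : 0 <= gauss_vec_prob h w.
Proof. by apply: prod_weight_ge0 => k; exact: gauss_prob_ge0. Qed.

Lemma sum_gauss_vec_prob (R : realType) (h : R) (K n : nat) :
  \sum_(w : {ffun 'I_n -> 'I_K.*2.+1}) gauss_vec_prob h w = 1.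
Proof. exact/sum_prod_weight/sum_gauss_prob. Qed.

(** The weight depends on the sample only through its squared norm, so comparing it with the weight
    of a translate amounts to expanding a dot product. *)
Lemma gauss_vec_probE (R : realType) (h : R) (K n : nat)
    (w : {ffun 'I_n -> 'I_K.*2.+1}) :
  gauss_vec_prob h w =
  expR (- (dot (grid_vec h w) (grid_vec h w) / 2)) / gauss_mass h K ^+ n.
Proof.
rewrite /gauss_vec_prob /prod_weight /gauss_prob big_split /=; congr (_ * _).
  rewrite /gauss -expR_sum sumrN mulr_suml; congr (expR (- _)).
  by apply: eq_bigr => i _; rewrite !mxE expr2.
by rewrite prodr_const card_ord exprVn.
Qed.

(** Chebyshev: since [x] is a unit vector, the variance of [dot x g] is that of one coordinate, at
    most 5/4. *)
Lemma gauss_vec_linear_tail (R : realType) (h : R) (K n : nat) (x : 'rV[R]_n) :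
    0 < h -> h <= 1 / 2 -> norm2 x = 1 ->
  \sum_(w : {ffun 'I_n -> 'I_K.*2.+1} | 16 <= dot x (grid_vec h w) ^+ 2)
     gauss_vec_prob h w <= 1 / 8.
Proof.
move=> h0 h1 x1.
have [S2 _] := gauss_prob_moments K h0 h1.
have := sum_markov 16 (@gauss_vec_prob_ge0 R h K n)
  (fun w => sqr_ge0 (dot x (grid_vec h w))).
have := @prod_weight_variance R n _ (gauss_prob h (K := K))
  (fun i k => x 0 i * grid h K k) (sum_gauss_prob h K).
move=> /(_ _)/wrap[i|].
  under eq_bigr do rewrite mulrCA.
  by rewrite -mulr_sumr gauss_prob_mean mulr0.
have -> : \sum_(i < n) \sum_(k < K.*2.+1)
      gauss_prob h k * (x 0 i * grid h K k) ^+ 2 =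
    \sum_(k < K.*2.+1) gauss_prob h k * grid h K k ^+ 2.
  transitivity (dot x x * \sum_(k < K.*2.+1) gauss_prob h k * grid h K k ^+ 2).
    rewrite /dot mulr_suml; apply: eq_bigr => i _; rewrite mulr_sumr.
    by apply: eq_bigr => k _; ring.
  by rewrite -sqr_norm2 x1 expr1n mul1r.
have -> : \sum_(w : {ffun 'I_n -> 'I_K.*2.+1})
      prod_weight (gauss_prob h (K := K)) w *
      (\sum_(i < n) x 0 i * grid h K (w i)) ^+ 2 =
    \sum_(w : {ffun 'I_n -> 'I_K.*2.+1})
      gauss_vec_prob h w * dot x (grid_vec h w) ^+ 2.
  apply: eq_bigr => w _; congr (_ * _ ^+ 2).
  by apply: eq_bigr => i _; rewrite mxE.
have : h ^+ 2 <= 1 / 4 by nra.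
lra.
Qed.

(** Chebyshev for the sum of squares: its mean is at most [n + 1], its variance at most [5 n] by the
    fourth moment, and the deviation is [6 sqrt n]. *)
Lemma gauss_vec_norm_tail (R : realType) (h : R) (K n : nat) :
    0 < h -> h <= 1 / 2 -> (0 < n)%N -> n%:R * h ^+ 2 <= 1 ->
  \sum_(w : {ffun 'I_n -> 'I_K.*2.+1} |
      n%:R + 1 + 6 * Num.sqrt n%:R <= dot (grid_vec h w) (grid_vec h w))
    gauss_vec_prob h w <= 5 / 36.
Proof.
move=> h0 h1 n0 nh.
have [S2 S4] := gauss_prob_moments K h0 h1.
set s2 := \sum_(k < _) _ * _ ^+ 2 in S2.
have s20 : 0 <= s2.
  by apply: sumr_ge0 => k _; rewrite mulr_ge0 ?sqr_ge0 ?gauss_prob_ge0.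
have nR : (0 : R) < n%:R by rewrite ltr0n.
pose X (w : {ffun 'I_n -> 'I_K.*2.+1}) : R :=
  (dot (grid_vec h w) (grid_vec h w) - n%:R * s2) ^+ 2.
have XE : \sum_w gauss_vec_prob h w * X w =
    n%:R * \sum_(k < K.*2.+1) gauss_prob h k * (grid h K k ^+ 2 - s2) ^+ 2.
  have := @prod_weight_variance R n _ (gauss_prob h (K := K))
    (fun i k => grid h K k ^+ 2 - s2) (sum_gauss_prob h K).
  move=> /(_ _)/wrap[i|].
    under eq_bigr do rewrite mulrBr.
    by rewrite sumrB -mulr_suml sum_gauss_prob mul1r subrr.
  rewrite sumr_const card_ord mulr_natl => <-.
  apply: eq_bigr => w _; congr (_ * _ ^+ 2).
  rewrite sumrB sumr_const card_ord mulr_natl; congr (_ - _).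
  by apply: eq_bigr => i _; rewrite !mxE expr2.
have VE : \sum_(k < K.*2.+1) gauss_prob h k * (grid h K k ^+ 2 - s2) ^+ 2 <= 5.
  apply: le_trans S4; rewrite -subr_ge0 -sumrB.
  rewrite [leRHS](_ : _ = \sum_(k < K.*2.+1) (2 * s2 * (gauss_prob h k *
     grid h K k ^+ 2) - gauss_prob h k * s2 ^+ 2)); last first.
    by apply: eq_bigr => k _; ring.
  rewrite sumrB -mulr_sumr -mulr_suml sum_gauss_prob -/s2; nra.
have M := @sum_markov R _ (gauss_vec_prob h (K := K) (n := n)) X (36 * n%:R)
  (@gauss_vec_prob_ge0 R h K n) (fun w => sqr_ge0 _).
rewrite XE in M; have {M VE} M := le_trans M (ler_wpM2l (ltW nR) VE).
rewrite -(ler_pM2l nR) -(ler_pM2l (_ : 0 < 36)) //.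
apply: le_trans (_ : _ <= n%:R * 5) _; last by lra.
apply: le_trans M; rewrite mulrA ler_wpM2l ?mulr_ge0 ?(ltW nR) //.
rewrite [leLHS]big_mkcond [leRHS]big_mkcond; apply: ler_sum => w _.
case: ifPn => [le|_]; last by case: ifP => // _; exact: gauss_vec_prob_ge0.
suff -> : 36 * n%:R <= X w by [].
have q0 : 0 <= Num.sqrt n%:R :> R by exact: sqrtr_ge0.
have qq : Num.sqrt n%:R ^+ 2 = n%:R :> R by rewrite sqr_sqrtr // ltW.
have ns : n%:R * s2 <= n%:R + 1.
  by apply: le_trans (_ : _ <= n%:R * (1 + h ^+ 2)) _;
    [rewrite ler_wpM2l // ltW | lra].
by rewrite /X -{1}qq; nra.
Qed.

Lemma gauss_vec_typical (R : realType) (h : R) (K n : nat) (x : 'rV[R]_n) :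
    0 < h -> h <= 1 / 2 -> (0 < n)%N -> n%:R * h ^+ 2 <= 1 -> norm2 x = 1 ->
  1 / 2 <= \sum_(w : {ffun 'I_n -> 'I_K.*2.+1} |
      (`|dot x (grid_vec h w)| <= 4) &&
      (dot (grid_vec h w) (grid_vec h w) <= n%:R + 1 + 6 * Num.sqrt n%:R))
    gauss_vec_prob h w.
Proof.
move=> h0 h1 n0 nh x1.
have T1 := gauss_vec_linear_tail K h0 h1 x1.
have T2 := gauss_vec_norm_tail K h0 h1 n0 nh.
have := sum_gauss_vec_prob h K n.
rewrite (bigID (fun w => (`|dot x (grid_vec h w)| <= 4) &&
  (dot (grid_vec h w) (grid_vec h w) <= n%:R + 1 + 6 * Num.sqrt n%:R))) /=.
set A := \sum_(w | _ && _) _; set B := \sum_(w | ~~ _) _ => AB.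
suff : B <= 1 / 8 + 5 / 36 by lra.
apply: le_trans (lerD T1 T2).
rewrite /B big_mkcond [X in _ <= X + _]big_mkcond [X in _ <= _ + X]big_mkcond.
rewrite -big_split /=.
apply: ler_sum => w _; have P0 := gauss_vec_prob_ge0 h w.
case: ifPn => [|_]; last by rewrite addr_ge0 //; case: ifP.
rewrite negb_and -!ltNge => /orP[lt|/ltW ->]; last first.
  by rewrite lerDr; case: ifP.
rewrite -[_ ^+ 2]real_normK ?num_real // ifT; last by nra.
by rewrite lerDl; case: ifP.
Qed.

(** * Slicing, rounding and translating on the grid *)

Lemma sum_pigeonhole (R : realType) (T : finType) (J : nat) (P : T -> R)
    (A : pred T) (B : 'I_J.+1 -> pred T) :
    (forall w, 0 <= P w) -> (forall w, A w -> exists j, B j w) ->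
  exists j, \sum_(w | A w) P w <= J.+1%:R * \sum_(w | A w && B j w) P w.
Proof.
move=> P0 AB; apply/not_existsP => lt.
have {}lt j : J.+1%:R * \sum_(w | A w && B j w) P w < \sum_(w | A w) P w.
  by rewrite ltNge; apply/negP/lt.
have : \sum_(w | A w) P w <= \sum_j \sum_(w | A w && B j w) P w.
  rewrite (exchange_big_dep A) /=; last by move=> j w _ /andP[].
  apply: ler_sum => w Aw; have [j Bj] := AB w Aw.
  rewrite (bigD1 j) ?Aw //= lerDl; apply: sumr_ge0 => i _; exact: P0.
apply/negP; rewrite -ltNge -(@ltr_pM2l _ J.+1%:R) // mulr_sumr.
apply: lt_le_trans (_ : _ < \sum_(j < J.+1) \sum_(w | A w) P w) _.
  apply: ltr_sum => [|j _]; last exact: lt.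
  by apply/hasP; exists ord0; rewrite ?mem_index_enum.
by rewrite sumr_const card_ord mulr_natl.
Qed.

Lemma exists_bin (R : realType) (J : nat) (l d t : R) :
    0 < d -> l <= t -> t <= l + J.+1%:R * d ->
  exists j : 'I_J.+1, l + j%:R * d <= t <= l + j%:R * d + d.
Proof.
move=> d0 lt tl; have y0 : 0 <= (t - l) / d by apply: divr_ge0; lra.
have /andP[] := truncn_itv y0; set k := Num.truncn _.
rewrite ler_pdivlMr // ltr_pdivrMr // => k1; rewrite -natr1 => k2.
have [kJ|Jk] := leqP k J.
  by exists (Ordinal (kJ : (k < J.+1)%N)) => /=; apply/andP; split; lra.
(* Only the right end of the range gets here; the last bin is closed and contains it. *)
exists ord_max => /=; rewrite -natr1 in tl.
have : (J%:R * d <= k%:R * d) by rewrite ler_pM2r // ler_nat ltnW.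
by move=> Jd; apply/andP; split; lra.
Qed.

Lemma exists_round (R : realType) (h t : R) :
  0 < h -> exists c : int, `|h * c%:~R - t| <= h.
Proof.
move=> h0; exists (Num.floor (t / h)).
have := floor_le (t / h); have := floorD1_gt (t / h).
rewrite intrD ltr_pdivrMr // ler_pdivlMr // => H1 H2.
by rewrite ler_norml; apply/andP; split; lra.
Qed.

Lemma grid_translate (R : realType) (h : R) (K : nat) (k : 'I_K.*2.+1)
    (c : int) :
    0 < h -> `|grid h K k + h * c%:~R| <= h * K%:R ->
  exists k' : 'I_K.*2.+1, grid h K k' = grid h K k + h * c%:~R.
Proof.
move=> h0; have -> : grid h K k + h * c%:~R = h * ((k%:Z - K%:Z + c)%:~R : R).
  by rewrite /grid !intrD intrN -!pmulrn; ring.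
rewrite normrM (gtr0_norm h0) ler_pM2l // -[K%:R]/(K%:Z%:~R) -intr_norm ler_int.
move=> cK; have lt : (`|(k%:Z + c)%R| < K.*2.+1)%N by lia.
exists (Ordinal lt); rewrite /grid /= -[X in X - _]/(`|(k%:Z + c)%R|%:Z%:~R).
rewrite gez0_abs; last by lia.
by rewrite -[K%:R]/(K%:Z%:~R) -intrB; congr (_ * _%:~R); lia.
Qed.

Lemma grid_inj (R : realType) (h : R) (K : nat) :
  0 < h -> injective (fun k : 'I_K.*2.+1 => grid h K k).
Proof.
move=> h0 k l /(mulfI (lt0r_neq0 h0)) /addIr /eqP.
by rewrite eqr_nat => /eqP/val_inj.
Qed.

Lemma exists_grid_vec (R : realType) (h : R) (K n : nat) (x : 'rV[R]_n) :
    0 < h -> (forall i, `|x 0 i| + h <= h * K%:R) ->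
  exists w : {ffun 'I_n -> 'I_K.*2.+1},
    forall i, `|grid_vec h w 0 i - x 0 i| <= h.
Proof.
move=> h0 xK.
have H i : exists k : 'I_K.*2.+1, `|grid h K k - x 0 i| <= h.
  have [c cx] := exists_round (x 0 i) h0.
  have K0 : (K < K.*2.+1)%N by lia.
  have E : grid h K K = 0 by rewrite /grid subrr mulr0.
  have [|k kE] := @grid_translate R h K (Ordinal K0) c h0.
    rewrite /= E add0r; apply: le_trans (xK i).
    rewrite -[h * _](subrK (x 0 i)) (le_trans (ler_normD _ _)) //.
    by rewrite addrC lerD2l.
  by exists k; rewrite kE /= E add0r.
have [f fP] := choice H.
by exists [ffun i => f i] => i; rewrite mxE ffunE.
Qed.

Lemma norm2_le_coord (R : realType) (n : nat) (h : R) (x : 'rV[R]_n) :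
  0 <= h -> (forall i, `|x 0 i| <= h) -> norm2 x <= n%:R * h.
Proof.
move=> h0 xh; rewrite -(@ler_pXn2r _ 2) ?nnegrE ?norm2_ge0 ?mulr_ge0 //.
rewrite sqr_norm2; apply: le_trans (_ : _ <= n%:R * h ^+ 2) _.
  rewrite -[n in n%:R]card_ord mulr_natl -sumr_const; apply: ler_sum => i _.
  rewrite -expr2 -[_ ^+ 2]real_normK ?num_real //.
  by rewrite ler_pXn2r ?nnegrE ?xh.
rewrite exprMn ler_wpM2r ?sqr_ge0 // -natrX ler_nat.
by rewrite -mulnn; nia.
Qed.

(* The law of [dot x g] being known only through its variance, translate a thin
   slice [a <= dot x g <= a + O(1 / s)] of the typical set, whose position [a]
   is provided by the pigeonhole principle, by a grid vector close to
   [(s - a) x]. It lands at height [s], and the terms in [a] of the translation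
   factor combine to [expR (a ^+ 2 / 2) >= 1], so any bounded [a] will do. *)
Lemma gauss_vec_hit (R : realType) (h : R) (K n J : nat) (x : 'rV[R]_n)
    (s : R) :
    (3 <= n)%N -> 0 < h -> h * n%:R ^+ 3 <= 1 -> h * K%:R = 3 * n%:R ->
    norm2 x = 1 -> 4 <= s -> s <= n%:R -> s <= J.+1%:R ->
  expR (- (s ^+ 2 / 2 + 25)) / (2 * J.+1%:R) <=
  \sum_(w : {ffun 'I_n -> 'I_K.*2.+1} |
      (s - n%:R * h <= dot x (grid_vec h w)) &&
      (dot (grid_vec h w) (grid_vec h w) <=
         n%:R + 6 * Num.sqrt n%:R + s ^+ 2 + 51))
    gauss_vec_prob h w.
Proof.
move=> n3 h0 hn hK x1 s4 sn sJ.
have N3 : 3 <= n%:R :> R by rewrite ler_nat.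
set N := n%:R in hn hK sn N3 *.
have hN2 : 3 * (h * N ^+ 2) <= 1.
  have : 0 <= h * N ^+ 2 by rewrite mulr_ge0 ?sqr_ge0 // ltW.
  move: hn; rewrite exprS; nra.
have hN : 9 * (h * N) <= 1.
  have : 0 <= h * N by rewrite mulr_ge0 //; lra.
  move: hN2; rewrite expr2; nra.
have h1 : h <= 1 / 2 by nra.
have nh : N * h ^+ 2 <= 1 by rewrite expr2; nra.
have n0 : (0 < n)%N by lia.
have sq0 : 0 <= Num.sqrt N by exact: sqrtr_ge0.
have sqN : Num.sqrt N ^+ 2 = N by rewrite sqr_sqrtr //; lra.
have sqle : Num.sqrt N <= N by nra.
have J0 : 0 < J.+1%:R :> R by [].
pose A (w : {ffun 'I_n -> 'I_K.*2.+1}) :=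
  (`|dot x (grid_vec h w)| <= 4) &&
  (dot (grid_vec h w) (grid_vec h w) <= N + 1 + 6 * Num.sqrt N).
have half : 1 / 2 <= \sum_(w | A w) gauss_vec_prob h w.
  exact: gauss_vec_typical.
(* [J.+1] slices of this width cover [[-4, 4]], and [s <= J.+1] yields [s * d <= 8]. *)
pose d : R := 8 / J.+1%:R.
have d0 : 0 < d by rewrite divr_gt0.
have Jd : J.+1%:R * d = 8 by rewrite /d mulrC divfK // gt_eqF.
pose B (j : 'I_J.+1) (w : {ffun 'I_n -> 'I_K.*2.+1}) :=
  -4 + j%:R * d <= dot x (grid_vec h w) <= -4 + j%:R * d + d.
have [j jP] : exists j, \sum_(w | A w) gauss_vec_prob h w <=
    J.+1%:R * \sum_(w | A w && B j w) gauss_vec_prob h w.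
  apply: sum_pigeonhole => [w|w /andP[]]; first exact: gauss_vec_prob_ge0.
  rewrite ler_norml => /andP[? ?] _; apply: exists_bin => //.
  by rewrite Jd; lra.
set a := -4 + j%:R * d in B jP *.
have [a1 a2] : -4 <= a /\ a <= 4.
  have : 0 <= j%:R * d by rewrite mulr_ge0 // ltW.
  have : j%:R * d <= J.+1%:R * d by rewrite ler_pM2r // ler_nat ltnW.
  by rewrite /a Jd; lra.
pose u := s - a.
have [u0 us] : 0 <= u /\ u <= 2 * s by rewrite /u; lra.
have uN : u <= 3 * N by rewrite /u; lra.
(* [cv] is [u *: x] rounded to the grid, and [r] is the rounding error. *)
have [c cP] := choice (fun i => exists_round (u * x 0 i) h0).
pose cv : 'rV[R]_n := \row_i (h * (c i)%:~R).
have [r cvE rN] : exists2 r, cv = u *: x + r & norm2 r <= N * h.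
  exists (cv - u *: x); first by rewrite addrC subrK.
  by apply: norm2_le_coord => [|i]; [exact: ltW | rewrite !mxE].
have xx : dot x x = 1 by rewrite -sqr_norm2 x1 expr1n.
have xr : `|dot x r| <= N * h.
  by apply: le_trans (normr_dot_le _ _) _; rewrite x1 mul1r.
have rr : dot r r <= 1.
  by rewrite -sqr_norm2; have := norm2_ge0 r; nra.
have step w : A w && B j w ->
    [/\ dot (grid_vec h w) cv + dot cv cv / 2 <= s ^+ 2 / 2 + 25,
      dot (grid_vec h w + cv) (grid_vec h w + cv) <=
        N + 6 * Num.sqrt N + s ^+ 2 + 51 &
      s - N * h <= dot x (grid_vec h w + cv)].
  rewrite /B -/a => /andP[/andP[_ gN] /andP[ag ga]].
  set g := grid_vec h w in gN ag ga *.
  have g3N : norm2 g <= 3 * N.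
    rewrite -(@ler_pXn2r _ 2) ?nnegrE ?norm2_ge0 //; last by lra.
    by rewrite sqr_norm2; nra.
  have gr : dot g r <= 1.
    apply: le_trans (dot_le _ _) _.
    apply: le_trans (ler_pM (norm2_ge0 _) (norm2_ge0 _) g3N rN) _.
    by move: hN2; rewrite expr2; lra.
  have xrle : dot x r <= N * h by apply: le_trans (ler_norm _) xr.
  have uxr : u * dot x r <= 1.
    apply: le_trans (ler_wpM2l u0 xrle) _.
    have Nh0 : 0 <= N * h by apply: mulr_ge0; lra.
    have := ler_wpM2r Nh0 uN.
    by move: hN2; rewrite expr2; lra.
  (* The main terms collapse to [(s ^+ 2 - a ^+ 2) / 2]; the slice width adds [u * d <= 16], and the
     terms in [r] stay bounded by a small constant. *)
  have E1 : dot g cv + dot cv cv / 2 <= s ^+ 2 / 2 + 25.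
    rewrite cvE !(dotDl, dotDr, dotZl, dotZr) xx (dotC g x) (dotC r x).
    have ug : u * dot x g <= u * (a + d) by rewrite ler_wpM2l.
    have ud : u * d <= 16.
      have sd : s * d <= J.+1%:R * d by rewrite ler_pM2r.
      have := ler_wpM2r (ltW d0) us; lra.
    have E : u * (a + d) + u ^+ 2 / 2 = s ^+ 2 / 2 - a ^+ 2 / 2 + u * d.
      by rewrite /u; field.
    have := sqr_ge0 a; move: E; rewrite expr2; lra.
  split=> //.
    (* The squared norm grows by twice the quantity in [E1], whence [51 = 1 + 2 * 25]. *)
    rewrite dotDl !dotDr (dotC cv g); lra.
  rewrite cvE !dotDr dotZr xx.
  by move: xr; rewrite ler_norml => /andP[xr _]; rewrite /u; lra.
(* Coordinates of the translate are bounded by its norm, hence by the half-width [3 n] of the grid.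
   Outside the slice [w] itself is a dummy value. *)
have shift w : exists w' : {ffun 'I_n -> 'I_K.*2.+1},
    A w && B j w -> grid_vec h w' = grid_vec h w + cv.
  have [AB|_] := boolP (A w && B j w); last by exists w.
  have [_ gN _] := step w AB.
  have g3N : norm2 (grid_vec h w + cv) <= h * K%:R.
    rewrite hK -(@ler_pXn2r _ 2) ?nnegrE ?norm2_ge0 //; last by lra.
    by rewrite sqr_norm2; nra.
  have H i : exists k : 'I_K.*2.+1,
      grid h K k = grid h K (w i) + h * (c i)%:~R.
    apply: grid_translate => //; apply: le_trans g3N.
    by have := norm2_coord_le (grid_vec h w + cv) i; rewrite !mxE.
  have [f fP] := choice H.
  by exists (finfun f) => _; apply/rowP => i; rewrite !mxE ffunE fP.
have [tau tauP] := choice shift.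
pose S := [set w | A w && B j w]%SET.
have tau_inj : {in S &, injective tau}.
  move=> w w'; rewrite !inE => Sw Sw' tE.
  apply/ffunP => i; apply: (grid_inj h0).
  have := tauP w' Sw'; rewrite -tE (tauP w Sw) => /addIr /rowP /(_ i).
  by rewrite !mxE.
apply: (@le_trans _ _ (\sum_(w in tau @: S) gauss_vec_prob h w)); last first.
  rewrite [leLHS]big_mkcond [leRHS]big_mkcond; apply: ler_sum => w _.
  case: ifPn => [/imsetP[w' Sw' ->]|_]; last first.
    by case: ifP => // _; exact: gauss_vec_prob_ge0.
  rewrite inE in Sw'; have [_ H1 H2] := step w' Sw'.
  by rewrite (tauP _ Sw') H1 H2.
rewrite big_imset //=.
(* The normalisation cancels, and translating by [cv] multiplies the weight by [expR] of minus the
   quantity bounded in [E1]. *)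
apply: (@le_trans _ _ (\sum_(w in S)
    expR (- (s ^+ 2 / 2 + 25)) * gauss_vec_prob h w)); last first.
  apply: ler_sum => w; rewrite inE => Sw; have [H _ _] := step w Sw.
  rewrite !gauss_vec_probE mulrA ler_pM2r; last first.
    by rewrite invr_gt0 exprn_gt0 // gauss_mass_gt0.
  rewrite -expRD ler_expR (tauP _ Sw) dotDl !dotDr (dotC cv).
  by lra.
rewrite -mulr_sumr ler_pM2l ?expR_gt0 //.
have -> : \sum_(w in S) gauss_vec_prob h w =
    \sum_(w | A w && B j w) gauss_vec_prob h w.
  by apply: eq_bigl => w; rewrite inE.
rewrite invfM -(ler_pM2l J0) mulrCA mulfV ?gt_eqF // mulr1.
by apply: le_trans jP; lra.
Qed.

(** * Covering the sphere *)

Lemma exists_unit_vector (R : realType) (n : nat) :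
  (0 < n)%N -> exists x : 'rV[R]_n, norm2 x = 1.
Proof.
move=> n0; exists (delta_mx 0 (Ordinal n0)).
rewrite /norm2 /dot (bigD1 (Ordinal n0)) //= !mxE !eqxx.
rewrite big1 ?addr0 ?mulr1 ?sqrtr1 // => i /negbTE i0.
by rewrite !mxE i0 mul0r.
Qed.

Lemma norm2_normalize (R : realType) (n : nat) (u : 'rV[R]_n) :
  norm2 u != 0 -> norm2 ((norm2 u)^-1 *: u) = 1.
Proof.
move=> u0; set a := (norm2 u)^-1; rewrite /norm2 dotZl dotZr -sqr_norm2 /a.
by rewrite (_ : _ * _ = 1) ?sqrtr1 //; field.
Qed.

(** Counts the grid values per coordinate; the exponent 5 is the constant in the threshold
    [5 * n * ln n] of the covering. *)
Lemma grid_size_le (n : nat) : (7 <= n)%N -> ((3 * n ^ 4).*2.+1 <= n ^ 5)%N.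
Proof.
move=> n7; rewrite (expnS n 4); apply: leq_trans (leq_mul n7 (leqnn _)).
have : (0 < n ^ 4)%N by rewrite expn_gt0 (leq_trans _ n7).
by move: (n ^ 4)%N => k; lia.
Qed.

Lemma sphere_cover (R : realType) (n m J : nat) (s : R) :
    (7 <= n)%N -> 4 <= s -> s <= n%:R -> s <= J.+1%:R ->
    5 * n%:R * ln n%:R <
      expR (- (s ^+ 2 / 2 + 25)) / (2 * J.+1%:R) * m%:R ->
  exists v : 'I_m -> 'rV[R]_n,
    (forall i, norm2 (v i) = 1) /\
    forall x : 'rV[R]_n, norm2 x = 1 -> exists i,
      (s - n%:R ^- 2) / Num.sqrt (n%:R + 6 * Num.sqrt n%:R + s ^+ 2 + 51)
        - 2 * n%:R ^- 2 <= dot x (v i).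
Proof.
move=> n7 s4 sn sJ.
set N : R := n%:R in sn *; set p := expR _ / _ => pm.
have N7 : 7 <= N by rewrite ler_nat.
have N0 : 0 < N by lra.
(* The grid covers [[-3 n, 3 n]], and its step makes the rounding error [n * h] equal to
   [n ^- 2]. *)
pose h : R := N ^- 3; pose K := (3 * n ^ 4)%N.
have h0 : 0 < h by rewrite invr_gt0 exprn_gt0.
have hn : h * N ^+ 3 = 1 by rewrite mulVf // expf_neq0 // gt_eqF.
have hK : h * K%:R = 3 * N.
  rewrite /K natrM natrX -/N (_ : _ * _ = 3 * N * (h * N ^+ 3)); last by ring.
  by rewrite hn mulr1.
have Nh : N * h = N ^- 2 by rewrite /h; field; rewrite gt_eqF.
have Nh1 : N * h <= 1.
  by rewrite Nh invf_le1 ?exprn_gt0 // exprn_ege1 //; lra.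
have h1 : h <= 1 by nra.
set rho := N + _ + _ + _.
have rho0 : 0 < rho.
  rewrite /rho; have := sqrtr_ge0 N; have := sqr_ge0 s; lra.
have [e1 e11] := exists_unit_vector R (leq_trans (isT : (0 < 7)%N) n7).
pose W := {ffun 'I_n -> 'I_K.*2.+1}.
pose rounds (x : 'rV[R]_n) (z : W) :=
  forall i, `|grid_vec h z 0 i - x 0 i| <= h.
(* Each grid point is represented by some unit vector rounding to it; if there is none, [e1] stands
   in, so that the hitting bound holds for every [z]. *)
have rep (z : W) : exists x, norm2 x = 1 /\
    ((exists2 y, norm2 y = 1 & rounds y z) -> rounds x z).
  have [[y y1 yz]|no] := pselect (exists2 y, norm2 y = 1 & rounds y z).
    by exists y.
  by exists e1.
have {rep} [X XP] := choice rep.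
pose hit (z w : W) := (s - N * h <= dot (X z) (grid_vec h w)) &&
  (dot (grid_vec h w) (grid_vec h w) <= rho).
have hitP z : p <= \sum_(w | hit z w) gauss_vec_prob h w.
  apply: gauss_vec_hit => //; first by lia.
    by rewrite hn.
  exact: (XP z).1.
have J0 : 0 < J.+1%:R :> R by [].
have p0 : 0 <= p by rewrite divr_ge0 ?expR_ge0 // mulr_ge0.
have p1 : p <= 1.
  apply: le_trans (hitP [ffun => ord0]) _; rewrite -(sum_gauss_vec_prob h K n).
  rewrite [leRHS](bigID (hit [ffun => ord0])) /= lerDl.
  by apply: sumr_ge0 => w _; exact: gauss_vec_prob_ge0.
have [t tm card_t] := greedy_cover (@gauss_vec_prob_ge0 R h K n)
  (sum_gauss_vec_prob h K n) p1 hitP m.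
(* At most [n ^ (5 n)] grid points, times [(1 - p) ^+ m <= expR (- (p * m))], is less than 1; a
   cardinal below 1 is 0. *)
have all_hit z : has (hit z) t.
  apply: contraT => zt; suff : #|[pred z | ~~ has (hit z) t]|%:R < 1 :> R.
    rewrite -[1]/(1%:R) ltr_nat ltnS leqn0 => /eqP/card0_eq/(_ z).
    by rewrite !inE zt.
  apply: le_lt_trans card_t _.
  have -> : (#|{: W}|%:R : R) = (K.*2.+1)%:R ^+ n.
    by rewrite card_ffun !card_ord natrX.
  apply: (@le_lt_trans _ _ (expR (5 * N * ln N) * expR (- (p * m%:R)))).
    apply: ler_pM; rewrite ?exprn_ge0 ?subr_ge0 //.
      have -> : 5 * N * ln N = n%:R * (5 * ln N) by rewrite -/N; ring.
      rewrite expRM_natl lerXn2r ?nnegrE ?expR_ge0 //.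
      rewrite expRM_natl lnK ?posrE // -natrX ler_nat.
      exact: grid_size_le.
    rewrite -(mulNr p m%:R) (mulrC (- p)) expRM_natl.
    rewrite lerXn2r ?nnegrE ?expR_ge0 ?subr_ge0 //.
    exact: expR_ge1Dx.
  by rewrite -expRD expR_lt1; lra.
pose w0 : W := [ffun => ord0].
pose g (i : 'I_m) := grid_vec h (nth w0 t i).
(* A zero sample cannot be normalised and is replaced by [e1]; a sample that hits has positive dot
   product and is never zero. *)
exists (fun i => if g i == 0 then e1 else (norm2 (g i))^-1 *: g i); split.
  move=> i; case: eqP => // /eqP gi.
  have : norm2 (g i) != 0.
    apply: contra gi => /eqP gi; apply/eqP/rowP => j.
    have := norm2_coord_le (g i) j; rewrite gi normr_le0 => /eqP ->.
    by rewrite mxE.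
  exact: norm2_normalize.
move=> x x1.
have xK i : `|x 0 i| + h <= h * K%:R.
  by rewrite hK; have := norm2_coord_le x i; rewrite x1; lra.
have [z zP] := exists_grid_vec h0 xK.
have [Xz1 Xz] := XP z; have {}Xz : rounds (X z) z by apply: Xz; exists x.
have /hasP[w wt /andP[hw1 hw2]] := all_hit z.
have wi : (index w t < m)%N by rewrite -tm index_mem.
exists (Ordinal wi); rewrite /g /= nth_index //.
have gpos : 0 < dot (X z) (grid_vec h w) by apply: lt_le_trans hw1; lra.
have norm_gt0 : 0 < norm2 (grid_vec h w).
  rewrite lt_def norm2_ge0 andbT; apply/eqP => g0.
  by have := dot_le (X z) (grid_vec h w); rewrite g0 mulr0 leNgt gpos.
rewrite ifN; last first.
  apply/eqP => g0; move: gpos; rewrite g0 /dot big1 ?ltxx // => i _.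
  by rewrite mxE mulr0.
rewrite dotZr -Nh.
have norm_le : norm2 (grid_vec h w) <= Num.sqrt rho by exact: ler_wsqrtr.
set ng := norm2 (grid_vec h w) in norm_gt0 norm_le *.
(* [x] and [X z] round to the same grid point, so their coordinates differ by at most [2 * h]. *)
have xX : - (2 * (N * h) * ng) <= dot (x - X z) (grid_vec h w).
  have dist : norm2 (x - X z) <= N * (2 * h).
    apply: norm2_le_coord => [|i]; first by lra.
    rewrite !mxE -(subrKA (grid_vec h z 0 i)) (le_trans (ler_normD _ _)) //.
    by rewrite distrC; have := zP i; have := Xz i; lra.
  have := normr_dot_le (x - X z) (grid_vec h w).
  rewrite ler_norml -/ng => /andP[le _]; apply: le_trans le.
  by have := ler_wpM2r (ltW norm_gt0) dist; lra.
have E : dot x (grid_vec h w) =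
    dot (X z) (grid_vec h w) + dot (x - X z) (grid_vec h w).
  by rewrite dotBl addrC subrK.
rewrite E mulrDr; apply: lerD; last first.
  by rewrite ler_pdivlMl // mulrC; move: xX; rewrite mulNr.
apply: (@le_trans _ _ ((s - N * h) / ng)); last first.
  by rewrite mulrC ler_pM2l ?invr_gt0.
have sNh : 0 < s - N * h by lra.
by rewrite (ler_pM2l sNh) lef_pV2 // posrE sqrtr_gt0.
Qed.

(** * Estimates of cap height and cap mass *)

(** In units of [1 / sqrt n], the height gives up [T^-1] by choice, at most [T^-1 / 2] through the
    excess norm because [T ^+ 4 <= 2 sqrt n], and [O(1 / sqrt n)] through rounding; the total fits
    in [3 / T]. *)
Lemma cap_height_le (R : realType) (n : nat) (T : R) :
    36 <= T -> T ^+ 4 <= 2 * Num.sqrt n%:R ->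
  T ^+ 2 / Num.sqrt n%:R * (1 - 3 / T ^+ 3) <=
  (T ^+ 2 - T^-1 - n%:R ^- 2) /
    Num.sqrt (n%:R + 6 * Num.sqrt n%:R + (T ^+ 2 - T^-1) ^+ 2 + 51)
    - 2 * n%:R ^- 2.
Proof.
move=> T36; set q := Num.sqrt n%:R => Tq.
have T0 : 0 < T by lra.
have nq : n%:R = q ^+ 2 :> R by rewrite sqr_sqrtr.
have T2 : 36 <= T ^+ 2 by rewrite expr2; nra.
have q6 : 100 <= q.
  have : T ^+ 4 = T ^+ 2 * T ^+ 2 by ring.
  nra.
have q0 : 0 < q by lra.
rewrite nq; set t := T^-1; set s := T ^+ 2 - t.
have tT : t * T = 1 by rewrite mulVf // gt_eqF.
have t0 : 0 < t by rewrite invr_gt0.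
have t1 : t <= 1 by nra.
have s0 : 0 <= s by rewrite /s; lra.
have sT : s <= T ^+ 2 by rewrite /s; lra.
have s2 : s ^+ 2 <= 2 * q.
  apply: le_trans Tq; rewrite -[4%N]/(2 * 2)%N exprM.
  by rewrite lerXn2r // nnegrE ?sqr_ge0.
set r := q^-1.
have rq : r * q = 1 by rewrite mulVf // gt_eqF.
have r0 : 0 < r by rewrite invr_gt0.
have r1 : r <= 1 by nra.
have -> : (q ^+ 2) ^- 2 = r ^+ 4 by rewrite /r; field; rewrite gt_eqF.
set rho := q ^+ 2 + _ + _ + _.
have rho_le : Num.sqrt rho <= q + 9.
  rewrite -[leRHS]ger0_norm ?sqrtr_sqr; last by lra.
  rewrite -sqrtr_sqr ler_wsqrtr // /rho; nra.
have rho0 : 0 < Num.sqrt rho.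
  by rewrite sqrtr_gt0 /rho; have := sqr_ge0 q; have := sqr_ge0 s; lra.
have r4 : r ^+ 4 <= r.
  by rewrite -[leRHS]expr1 ler_wiXn2l // ltW.
have sr : 0 <= s - r ^+ 4 by rewrite /s; lra.
(* This linearises [1 / (q + 9)]: with [r * q = 1], the product [r (1 - 9 r) (q + 9)] equals
   [1 - 81 r ^+ 2]. *)
apply: (@le_trans _ _ ((s - r ^+ 4) * (r * (1 - 9 * r)) - 2 * r ^+ 4));
  last first.
  rewrite lerD2r ler_wpM2l //.
  rewrite -[leRHS]mul1r ler_pdivlMr //.
  apply: (@le_trans _ _ (r * (1 - 9 * r) * (q + 9))).
    by apply: ler_wpM2l => //; apply: mulr_ge0; nra.
  have -> : r * (1 - 9 * r) * (q + 9) =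
      (r * q) * (1 - 9 * r) + 9 * r - 81 * r ^+ 2.
    by ring.
  by rewrite rq; have := sqr_ge0 r; lra.
have -> : T ^+ 2 * r * (1 - 3 / T ^+ 3) = r * (T ^+ 2 - 3 * t).
  by rewrite /t; field; rewrite gt_eqF.
have -> : (s - r ^+ 4) * (r * (1 - 9 * r)) - 2 * r ^+ 4 =
  r * ((s - r ^+ 4) * (1 - 9 * r) - 2 * r ^+ 3) by ring.
rewrite ler_pM2l //.
have r3 : r ^+ 3 <= r.
  by rewrite -[leRHS]expr1 ler_wiXn2l // ltW.
have T2r : T ^+ 2 * r <= t / 18.
  have : T ^+ 4 * r <= 2 by nra.
  have -> : T ^+ 4 = T ^+ 2 * T ^+ 2 by ring.
  have -> : T ^+ 2 * T ^+ 2 * r = (T ^+ 2 * r) * T * T by ring.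
  have : 0 <= T ^+ 2 * r by rewrite mulr_ge0 ?sqr_ge0 // ltW.
  set y := T ^+ 2 * r => y0 yTT.
  have yT : y * T <= 1 / 18 by nra.
  have := ler_wpM2r (ltW t0) yT.
  have -> : y * T * t = y * (t * T) by ring.
  rewrite tT; lra.
have rr : r <= T ^+ 2 * r / 36 by nra.
have : (s - r ^+ 4) * (9 * r) <= 9 * (T ^+ 2 * r).
  apply: (@le_trans _ _ (T ^+ 2 * (9 * r))); last by lra.
  rewrite ler_wpM2r //; first by lra.
  by have := exprn_ge0 4 (ltW r0); lra.
rewrite /s; lra.
Qed.

(** Lowering the height from [T ^+ 2] by [T^-1] gains [expR (T - T ^- 2 / 2)], which beats the
    number of slices and [ln n], together of order [T ^+ 6]. The threshold on [T] comes from the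
    term [T ^+ 7 / 7!] of the exponential series. *)
Lemma cap_mass_ge (R : realType) (n J : nat) (T : R) :
    10 * 7`!%:R * expR 26 <= T -> (0 < n)%N -> 2 * ln n%:R <= T ^+ 4 ->
    J%:R <= T ^+ 2 - T^-1 ->
  5 * n%:R * ln n%:R <
    expR (- ((T ^+ 2 - T^-1) ^+ 2 / 2 + 25)) / (2 * J.+1%:R) *
    (n%:R * expR (T ^+ 4 / 2)).
Proof.
move=> Tbig n0 lnT JT.
have N0 : (0 : R) < n%:R by rewrite ltr0n.
have e26 : 1 <= expR 26 :> R by have := expR_ge1Dx (26 : R); lra.
have F1 : 1 <= 7`!%:R :> R by rewrite ler1n fact_gt0.
have T1 : 10 <= T by nra.
have T0 : 0 < T by lra.
have J0 : 0 < J.+1%:R :> R by [].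
have tT : T^-1 * T = 1 by rewrite mulVf // gt_eqF.
have t0 : 0 < T^-1 by rewrite invr_gt0.
have JT2 : J.+1%:R <= 2 * T ^+ 2.
  have : 1 <= T ^+ 2 by rewrite exprn_ege1 //; lra.
  by rewrite -natr1; lra.
have -> : expR (- ((T ^+ 2 - T^-1) ^+ 2 / 2 + 25)) / (2 * J.+1%:R) *
    (n%:R * expR (T ^+ 4 / 2)) =
    n%:R * (expR (T - (T^-1) ^+ 2 / 2 - 25) / (2 * J.+1%:R)).
  rewrite (_ : T - _ - _ = - ((T ^+ 2 - T^-1) ^+ 2 / 2 + 25) + T ^+ 4 / 2).
    by rewrite expRD; ring.
  by field; rewrite gt_eqF.
rewrite mulrAC mulrC ltr_pM2l // ltr_pdivlMr ?mulr_gt0 //.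
apply: (@le_lt_trans _ _ (10 * T ^+ 6)).
  apply: (@le_trans _ _ (5 * (T ^+ 4 / 2) * (2 * (2 * T ^+ 2)))).
    have l0 : 0 <= ln (n%:R : R) by rewrite ln_ge0 // ler1n.
    by apply: ler_pM; rewrite ?mulr_ge0 //; lra.
  by rewrite le_eqVlt; apply/orP; left; apply/eqP; field.
apply: (@lt_le_trans _ _ (expR (T - 26))); last first.
  rewrite ler_expR; have : (T^-1) ^+ 2 <= 1.
    by rewrite exprn_ile1 ?(ltW t0) //; nra.
  lra.
rewrite -(ltr_pM2l (expR_gt0 26)) -expRD addrC subrK.
apply: lt_le_trans (expR_ge1Dxn 6 (ltW T0)).
apply: (@le_lt_trans _ _ (T ^+ 7 / 7`!%:R)); last by rewrite ltrDr.
rewrite ler_pdivlMr; last by lra.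
rewrite (_ : _ * _ * _ = 10 * 7`!%:R * expR 26 * T ^+ 6); last by ring.
by rewrite (exprS T 6) ler_wpM2r // exprn_ge0 // ltW.
Qed.

(** * Range of [m] and conclusion *)

Lemma ln2_ge_half (R : realType) : 1 / 2 <= ln (2 : R).
Proof.
rewrite -ler_expR lnK ?posrE // -[leRHS]invrK -[leLHS]invrK -expRN.
rewrite lef_pV2 ?posrE ?expR_gt0 ?invr_gt0 //.
by have := expR_ge1Dx (- (1 / 2) : R); lra.
Qed.

Lemma ln2_le1 (R : realType) : ln (2 : R) <= 1.
Proof. by have := @le_ln1Dx R 1 ltac:(lra); rewrite -[1 + 1]/(2%:R). Qed.

(** The upper bound on [d] makes [m / n] at least [n], and the lower bound makes its logarithm at
    most [|f|]; the ceiling adds less than 1, which is absorbed since [1 / d >= 4] and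
    [2 n ln n >= 2]. *)
Lemma delta_size_bounds (R : realType) (n m : nat) (d f : R) :
    (2 <= n)%N -> m = `|Num.ceil (1 / d)|%N ->
    2 `^ (- f) < d -> d < 1 / n%:R ^+ 2 ->
  [/\ 1 / d <= m%:R, m%:R <= 2 * n%:R * ln n%:R / d,
      n%:R <= m%:R / n%:R :> R & ln (m%:R / n%:R) <= `|f| ].
Proof.
move=> n2 mE fd dn.
have N2 : 2 <= n%:R :> R by rewrite ler_nat.
set N : R := n%:R in dn N2 *.
have d0 : 0 < d by apply: lt_trans fd; rewrite powR_gt0.
have NN : N ^+ 2 < 1 / d.
  rewrite ltr_pdivlMr // mulrC -ltr_pdivlMr //.
  by rewrite exprn_gt0 //; lra.
have d4 : 4 <= 1 / d by nra.
have mR : m%:R = (Num.ceil (1 / d))%:~R :> R.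
  rewrite mE -[LHS]/((`|Num.ceil (1 / d)|%N)%:Z%:~R) gez0_abs //.
  by rewrite ceil_ge0; lra.
have /andP[] := ceil_itv (1 / d); rewrite intrB -mR => m2 m1.
have N0 : 0 < N by lra.
have lnN : 1 / 2 <= ln N.
  by apply: le_trans (ln2_ge_half R) _; rewrite ler_ln ?posrE.
split=> //.
- apply: (@le_trans _ _ (2 * (1 / d))); first by lra.
  by rewrite mulrA mulr1 ler_pM2r ?invr_gt0 //; nra.
- by rewrite ler_pdivlMr //; move: NN; rewrite expr2; lra.
have xd : m%:R / N <= 1 / d.
  rewrite ler_pdivrMr //; nra.
have x0 : 0 < m%:R / N by rewrite divr_gt0 //; lra.
have df : 1 / d <= expR (f * ln 2).
  rewrite div1r invf_ple ?posrE ?expR_gt0 // -expRN -mulNr.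
  by move: fd; rewrite /powR ifF ?pnatr_eq0 // => /ltW.
have : ln (m%:R / N) <= f * ln 2.
  by rewrite -ler_expR lnK ?posrE // (le_trans xd).
move=> /le_trans; apply; apply: le_trans (ler_norm _) _.
rewrite normrM ler_piMr // ger0_norm ?ln2_le1 //; have := ln2_ge_half R; lra.
Qed.

Lemma sphere_cover_large (R : realType) (n m : nat) (T : R) :
    36 <= T -> 10 * 7`!%:R * expR 26 <= T -> (7 <= n)%N -> (0 < m)%N ->
    T ^+ 4 = 2 * ln (m%:R / n%:R) -> n%:R <= m%:R / n%:R :> R ->
    ln (m%:R / n%:R) <= Num.sqrt (n%:R : R) ->
  exists v : 'I_m -> 'rV[R]_n,
    (forall i, norm2 (v i) = 1) /\
    forall x : 'rV[R]_n, norm2 x = 1 -> exists i,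
      Num.sqrt (2 * ln (m%:R / n%:R) / n%:R) * (1 - 3 / T ^+ 3) <= dot x (v i).
Proof.
move=> T36 Tbig n7 m0 TL nm Ln.
set N : R := n%:R in TL nm Ln *.
have N7 : 7 <= N by rewrite ler_nat.
have T0 : 0 < T by lra.
have x0 : 0 < m%:R / N by rewrite divr_gt0 ?ltr0n //; lia.
have Tq : T ^+ 4 <= 2 * Num.sqrt N by rewrite TL; lra.
have tT : T^-1 * T = 1 by rewrite mulVf // gt_eqF.
have t0 : 0 < T^-1 by rewrite invr_gt0.
have t1 : T^-1 <= 1 by nra.
have TT : 36 * 36 <= T ^+ 2 by rewrite expr2; nra.
have sqN : Num.sqrt N ^+ 2 = N by rewrite sqr_sqrtr //; lra.
have s0 : 0 <= T ^+ 2 - T^-1 by lra.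
(* The number of slices [J.+1] is the least allowed by [s <= J.+1] up to rounding, so it costs only
   a factor of order [T ^+ 2]. *)
have /andP[J1 J2] := truncn_itv s0; set J := Num.truncn _ in J1 J2.
have [||||v [v1 vP]] := @sphere_cover R n m J (T ^+ 2 - T^-1) n7.
- lra.
- rewrite -/N; have : T ^+ 4 = T ^+ 2 * T ^+ 2 by ring.
  move=> T4; have Tq' : T ^+ 2 <= Num.sqrt N by nra.
  have : 0 <= (Num.sqrt N - 1) * Num.sqrt N by apply: mulr_ge0; lra.
  by move: sqN; rewrite expr2; lra.
- exact: ltW.
- have -> : m%:R = N * expR (T ^+ 4 / 2).
    rewrite TL mulrAC mulfV // mul1r lnK ?posrE //.
    by rewrite mulrC divfK // gt_eqF; lra.
  apply: (cap_mass_ge Tbig) (leq_trans _ n7) _ J1 => //.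
  by rewrite TL ler_pM2l // ler_ln ?posrE // -/N; lra.
exists v; split=> // x x1; have [i vi] := vP x x1; exists i.
apply: le_trans vi.
have -> : Num.sqrt (2 * ln (m%:R / N) / N) = T ^+ 2 / Num.sqrt N.
  rewrite -TL sqrtrM ?exprn_ge0 ?(ltW T0) // sqrtrV; last by lra.
  by rewrite -[4%N]/(2 * 2)%N exprM sqrtr_sqr ger0_norm // sqr_ge0.
exact: cap_height_le.
Qed.

Theorem theorem6 (R : realType) (delta f : nat -> R)
    (hf : f =o_\oo (fun n : nat => Num.sqrt n%:R : R))
    (hdelta : forall n : nat, (2 <= n)%N ->
       2 `^ (- f n) < delta n /\ delta n < 1 / n%:R ^+ 2) :
  exists (m : nat -> nat) (v : forall n : nat, 'I_(m n) -> 'rV[R]_n)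
         (e : nat -> R),
    e =o_\oo (fun n : nat => 1 / Num.sqrt (log2 ((m n)%:R / n%:R)) : R) /\
    forall n : nat, (2 <= n)%N ->
      [/\ 1 / delta n <= (m n)%:R,
          (m n)%:R <= 2 * n%:R * ln n%:R / delta n,
          forall i : 'I_(m n), sphere R n (v n i) &
          forall x : 'rV[R]_n, sphere R n x ->
            exists i : 'I_(m n),
              Num.sqrt (2 * ln ((m n)%:R / n%:R) / n%:R) * (1 - e n)
                <= dot x (v n i)].
Proof.
pose m n := `|Num.ceil (1 / delta n)|%N.
have mP n : (2 <= n)%N -> [/\ 1 / delta n <= (m n)%:R,
    (m n)%:R <= 2 * n%:R * ln n%:R / delta n,
    n%:R <= (m n)%:R / n%:R :> R & ln ((m n)%:R / n%:R) <= `|f n| ].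
  by move=> n2; have [d1 d2] := hdelta n n2; exact: delta_size_bounds d1 d2.
pose L n : R := ln ((m n)%:R / n%:R).
pose T n : R := Num.sqrt (Num.sqrt (2 * L n)).
have lnL n : (2 <= n)%N -> ln n%:R <= L n.
  move=> n2; have [_ _ nm _] := mP n n2.
  have N0 : (0 : R) < n%:R by rewrite ltr0n; lia.
  by rewrite ler_ln ?posrE // (lt_le_trans N0).
have L0 n : (2 <= n)%N -> 0 < L n.
  by move=> n2; apply: lt_le_trans (lnL n n2); rewrite ln_gt0 // ltr1n.
have TL n : (2 <= n)%N -> T n ^+ 4 = 2 * L n.
  move=> n2; have := L0 n n2 => Ln0.
  by rewrite -[4%N]/(2 * 2)%N exprM !sqr_sqrtr ?sqrtr_ge0 //; lra.
have T_large (B : R) : \forall n \near \oo, B <= T n.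
  near=> n.
  have n2 : (2 <= n)%N by near: n; exact: nbhs_infty_ge.
  have [B0|/ltW B0] := leP B 0; first by rewrite (le_trans B0) ?sqrtr_ge0.
  rewrite -(@ler_pXn2r _ 4) ?nnegrE ?sqrtr_ge0 // TL //.
  apply: (@le_trans _ _ (ln n%:R)); last first.
    by have := lnL n n2; have := L0 n n2; lra.
  rewrite -ler_expR lnK ?posrE ?ltr0n; last by lia.
  by near: n; exact: nbhs_infty_ger.
have f_le : \forall n \near \oo, `|f n| <= Num.sqrt (n%:R : R).
  move/eqoP: hf => /(_ 1 ltr01); apply: filterS => n.
  by rewrite mul1r [leRHS]ger0_norm ?sqrtr_ge0.
have [n0 _ n0P] : \forall n \near \oo, [/\ 36 <= T n,
    10 * 7`!%:R * expR 26 <= T n, `|f n| <= Num.sqrt (n%:R : R) & (7 <= n)%N].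
  near=> n; split; near: n; [exact: T_large | exact: T_large | exact: f_le |].
  exact: nbhs_infty_ge.
(* For [2 <= n < n0] the second value turns the claimed lower bound into exactly -1. *)
pose e n : R := if (n0 <= n)%N then 3 / T n ^+ 3
  else 1 + (Num.sqrt (2 * L n / n%:R))^-1.
have m_gt0 n : (2 <= n)%N -> (0 < m n)%N.
  move=> n2; rewrite lt0n; apply/eqP => m0; have [_ _ + _] := mP n n2.
  by rewrite m0 mul0r lern0 => /eqP n_0; rewrite n_0 in n2.
have H n : exists v : 'I_(m n) -> 'rV[R]_n, (2 <= n)%N ->
    (forall i, norm2 (v i) = 1) /\
    forall x : 'rV[R]_n, norm2 x = 1 -> exists i,
      Num.sqrt (2 * L n / n%:R) * (1 - e n) <= dot x (v i).
  have [n2|n2] := leqP 2 n; last first.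
    (* Nothing is claimed for [n < 2], so any family serves. *)
    by exists (fun=> 0).
  rewrite /e; case: ifP => nn0.
    have [T1 T2 fn n7] := n0P n nn0; have [_ _ nm Lf] := mP n n2.
    have [v vP] := sphere_cover_large T1 T2 n7 (m_gt0 n n2) (TL n n2) nm
      (le_trans Lf fn).
    by exists v.
  have [u u1] := exists_unit_vector R (ltnW n2).
  exists (fun=> u) => _; split=> // x x1; exists (Ordinal (m_gt0 n n2)).
  have := normr_dot_le x u; rewrite x1 u1 mulr1 ler_norml => /andP[xu _].
  have sq0 : 0 < Num.sqrt (2 * L n / n%:R).
    by rewrite sqrtr_gt0 divr_gt0 ?mulr_gt0 ?L0 // ltr0n; lia.
  by rewrite opprD addrA subrr add0r mulrN mulfV // gt_eqF.
pose v n := projT1 (cid (H n)).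
exists m, v, e; split; last first.
  move=> n n2; have [d1 d2 _ _] := mP n n2.
  have [v1 v2] := projT2 (cid (H n)) n2.
  by split.
apply/eqoP => eps eps0; near=> n.
have n2 : (2 <= n)%N by near: n; exact: nbhs_infty_ge.
have nn0 : (n0 <= n)%N by near: n; exact: nbhs_infty_ge.
have [T36 _ _ _] := n0P n nn0.
have T0 : 0 < T n by lra.
have Teps : 3 / eps <= T n by near: n; exact: T_large.
have Ln0 := L0 n n2.
have T2 : T n ^+ 2 = Num.sqrt (2 * L n) by rewrite sqr_sqrtr ?sqrtr_ge0.
have l2 := ln2_ge_half R.
have logL : 0 < log2 ((m n)%:R / n%:R : R) <= 2 * L n.
  rewrite /log2 -/(L n); apply/andP; split; first by apply: divr_gt0; lra.
  by rewrite ler_pdivrMr; [nra|lra].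
have /andP[log0 log1] := logL.
have T3 : 0 <= 3 / T n ^+ 3 by rewrite divr_ge0 // exprn_ge0 // ltW.
rewrite /e nn0 (ger0_norm T3) [in leRHS]ger0_norm ?divr_ge0 ?sqrtr_ge0 //.
(* [ln 2 >= 1 / 2] gives [log2 (m / n) <= 2 L = T ^+ 4], so the comparison function is at least
   [1 / T ^+ 2], while [e] is [3 / T ^+ 3]; the ratio is at most [3 / T]. *)
apply: (@le_trans _ _ (eps * (1 / T n ^+ 2))); last first.
  rewrite ler_pM2l // !div1r lef_pV2 ?posrE ?exprn_gt0 ?sqrtr_gt0 //.
    by rewrite T2 ler_wsqrtr.
  by rewrite mulr_gt0.
rewrite ler_pdivrMr ?exprn_gt0 //.
have -> : eps * (1 / T n ^+ 2) * T n ^+ 3 = eps * T n.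
  by field; rewrite gt_eqF.
by move: Teps; rewrite ler_pdivrMr // mulrC.
Unshelve. all: by end_near.
Qed.
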